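(* Let $k>1$ be an integer. Then all positive integer solutions $(x,y)$ of the equation $x^{2}-(k^{2}+4)y^{2}=4$ are given by $$(x,y)=(V_{2n}(k,1),U_{2n}(k,1))$$ with $n\geq 1$. That is, the set of pairs of positive integers solving the equation is exactly the set of these pairs as $n$ ranges over the integers $n\ge 1$.
   Context: For nonzero integers $k,s$ with $k^{2}+4s>0$, the generalized Fibonacci sequence is defined by $U_{0}(k,s)=0$, $U_{1}(k,s)=1$, $U_{n+1}(k,s)=kU_{n}(k,s)+sU_{n-1}(k,s)$ for $n\ge 1$, and the generalized Lucas sequence by $V_{0}(k,s)=2$, $V_{1}(k,s)=k$, $V_{n+1}(k,s)=kV_{n}(k,s)+sV_{n-1}(k,s)$ for $n\ge 1$. *)

(* Defs.v *)
From mathcomp Require Import all_boot all_order all_algebra.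

Set Implicit Arguments.
Unset Strict Implicit.
Unset Printing Implicit Defensive.

Local Open Scope ring_scope.

(* The sequences are usually considered for k, s nonzero with k^2 + 4s > 0;
   the recursion makes sense, and is defined here, for all integers k, s. *)
Fixpoint genFib (k s : int) (n : nat) : int :=
  match n with
  | 0%N => 0
  | n1.+1 =>
      match n1 with
      | 0%N => 1
      | n2.+1 => k * genFib k s n1 + s * genFib k s n2
      end
  end.

Fixpoint genLucas (k s : int) (n : nat) : int :=
  match n with
  | 0%N => 2
  | n1.+1 =>
      match n1 with
      | 0%N => k
      | n2.+1 => k * genLucas k s n1 + s * genLucas k s n2
      end
  end.

(* Main.v *)
Require Import Defs.
From mathcomp Require Import all_boot all_order all_algebra.
From mathcomp Require Import ring zify.
Import Order.TTheory GRing.Theory Num.Theory.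

(** Substituting [x = k * y + 2 * q] (the equation forces [x] and [k * y] to
    have the same parity) turns [x ^+ 2 - (k ^+ 2 + 4) * y ^+ 2 = 4] into
    [q ^+ 2 + k * q * y - y ^+ 2 = 1], a value of the quadratic form of
    Cassini's identity.  On consecutive terms [(U_n, U_{n+1})] that form takes
    the value [(-1)^(n+1)] ([cassini_genFib]); conversely, running the
    recurrence backwards, [(a, b) -> (b - k * a, a)], flips the sign of the form
    and makes the pair smaller while keeping it nonnegative, so that each pair
    with [0 <= a], [0 < b] and form [1] or [-1] descends to [(0, 1)] and hence consists of
    consecutive terms ([genFib_of_cassini]).  The value [1] then selects the
    pairs [(U_{2n-1}, U_{2n})], and [x = k * U_{2n} + 2 * U_{2n-1}] is
    [V_{2n}] ([genLucas_genFib]). *)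

Local Open Scope ring_scope.

(** The quadratic form of Cassini's identity: since
    [U_{n+2} = k * U_{n+1} + U_n], its value at [(U_n, U_{n+1})] is
    [U_n * U_{n+2} - U_{n+1} ^+ 2]. *)
Definition cassini (k a b : int) : int := a ^+ 2 + k * a * b - b ^+ 2.

Lemma genFibSS (k s : int) (n : nat) :
  genFib k s n.+2 = k * genFib k s n.+1 + s * genFib k s n.
Proof. by []. Qed.

Lemma genLucasSS (k s : int) (n : nat) :
  genLucas k s n.+2 = k * genLucas k s n.+1 + s * genLucas k s n.
Proof. by []. Qed.

Lemma genLucas_genFib (k s : int) (n : nat) :
  genLucas k s n.+1 = k * genFib k s n.+1 + 2 * s * genFib k s n.
Proof.
suff [] : genLucas k s n.+1 = k * genFib k s n.+1 + 2 * s * genFib k s n /\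
  genLucas k s n.+2 = k * genFib k s n.+2 + 2 * s * genFib k s n.+1 by [].
elim: n => [|n [IH1 IH2]]; first by split => /=; ring.
split=> //; rewrite genLucasSS IH1 IH2 (genFibSS k s n.+1) (genFibSS k s n).
ring.
Qed.

Lemma cassini_step (k a b : int) : cassini k b (k * b + a) = - cassini k a b.
Proof. rewrite /cassini; ring. Qed.

Lemma cassini_genFib (k : int) (n : nat) :
  cassini k (genFib k 1 n) (genFib k 1 n.+1) = (-1) ^+ n.+1.
Proof.
elim: n => [|n IH]; first by rewrite /cassini /=; ring.
by rewrite genFibSS mul1r cassini_step IH [RHS]exprS mulN1r.
Qed.

Lemma genFibS_gt0 (k : int) (hk : 0 < k) (n : nat) : 0 < genFib k 1 n.+1.
Proof.
suff [] : 0 < genFib k 1 n.+1 /\ 0 <= genFib k 1 n by [].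
elim: n => [//|n [pos1 pos0]]; rewrite genFibSS mul1r; split; last exact: ltW.
by apply: ltr_wpDr => //; apply: mulr_gt0.
Qed.

(** Descent along [(a, b) -> (b - k * a, a)].  For [0 < a] the new pair is
    again nonnegative: if [b < k * a], then the form is at least
    [a ^+ 2 + b >= 2].  As [0 < k * a], the sum [a + b] drops; it is a better
    measure than [b], which does not drop at [(1, 1)] when [k = 1]. *)
Lemma genFib_of_cassini (k : int) (hk : 0 < k) (a b : int) :
  0 <= a -> 0 < b -> cassini k a b = 1 \/ cassini k a b = -1 ->
  exists n : nat, a = genFib k 1 n /\ b = genFib k 1 n.+1.
Proof.
have [m] := ubnP `|(a + b)%R|%N.
elim: m a b => [//|m IH] a b lt_m a0 b0 hQ.
have [a_eq0|a_neq0] := eqVneq a 0.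
  exists 0%N; split=> //=; move: hQ; rewrite /cassini a_eq0; nia.
have a_gt0 : 0 < a by lia.
have le_ka_b : 0 <= b - k * a.
  have [//|] := leP 0 (b - k * a) => lt0; move: hQ; rewrite /cassini; nia.
have sum_drop : (`|(b - k * a + a)%R| < m)%N by nia.
have hQ' : cassini k (b - k * a) a = 1 \/ cassini k (b - k * a) a = -1.
  have := cassini_step k (b - k * a) a.
  have -> : k * a + (b - k * a) = b by ring.
  lia.
have [n [eq_n eq_n1]] := IH _ _ sum_drop le_ka_b a_gt0 hQ'.
exists n.+1; split=> //; rewrite genFibSS -eq_n -eq_n1; ring.
Qed.

Lemma pell_cassini (k q y : int) :
  (k * y + 2 * q) ^+ 2 - (k ^+ 2 + 4) * y ^+ 2 = 4 * cassini k q y.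
Proof. rewrite /cassini; ring. Qed.

(** Modulo 2 the equation reads [x ^+ 2 = (k * y) ^+ 2]. *)
Lemma pell_parity (k x y : int) :
  x ^+ 2 - (k ^+ 2 + 4) * y ^+ 2 = 4 -> exists q : int, x = k * y + 2 * q.
Proof.
move=> hx.
have [q [hq|hq]] : exists q, x - k * y = 2 * q \/ x - k * y = 2 * q + 1.
  by exists (divz (x - k * y) 2); lia.
  by exists q; lia.
have x_odd : x = k * y + 2 * q + 1 by lia.
have : 2 * (2 * q ^+ 2 + 2 * q + k * y * (2 * q + 1) - 2 * y ^+ 2) + 1 = 4.
  rewrite -hx x_odd; ring.
lia.
Qed.

Theorem theorem10 (k : int) (hk : 1 < k) (x y : int) :
  (0 < x /\ 0 < y /\ x ^+ 2 - (k ^+ 2 + 4) * y ^+ 2 = 4) <->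
  (exists n : nat, (1 <= n)%N /\
     (x, y) = (genLucas k 1 (2 * n)%N, genFib k 1 (2 * n)%N)).
Proof.
have k_gt0 : 0 < k by lia.
split=> [[x_gt0 [y_gt0 hxy]]|[[|n] [n_ge1 xy_eq]]] //.
- have [q x_eq] := pell_parity k x y hxy.
  have hQ : cassini k q y = 1 by move: hxy; rewrite x_eq pell_cassini; lia.
  (* For [q < 0], [0 < x] means [- 2 * q < k * y], making the form negative. *)
  have q_ge0 : 0 <= q.
    have [//|q_lt0] := leP 0 q; move: hQ; rewrite /cassini; nia.
  have [n [eq_q eq_y]] := genFib_of_cassini k k_gt0 q y q_ge0 y_gt0 (or_introl hQ).
  have n1_even : ~~ odd n.+1.
    move: hQ; rewrite eq_q eq_y cassini_genFib -signr_odd.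
    by case: (odd n.+1).
  have eq_n1 : (2 * (n.+1)./2 = n.+1)%N by rewrite mul2n even_halfK.
  exists (n.+1)./2; split; first by lia.
  by rewrite eq_n1 genLucas_genFib mulr1 -eq_q -eq_y x_eq.
- have eq_n2 : (2 * n.+1 = (2 * n).+2)%N by lia.
  rewrite eq_n2 in xy_eq.
  have -> : x = genLucas k 1 (2 * n).+2 := congr1 fst xy_eq.
  have -> : y = genFib k 1 (2 * n).+2 := congr1 snd xy_eq.
  have y_gt0 := genFibS_gt0 k k_gt0 (2 * n).+1.
  have q_gt0 := genFibS_gt0 k k_gt0 (2 * n).
  rewrite genLucas_genFib mulr1; split; first by nia.
  split=> //; rewrite pell_cassini cassini_genFib -signr_odd.
  by rewrite /= mul2n odd_double.
Qed.
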